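(* Let $(X,\mathbb{A},d)$ be a $C^{\ast}$-algebra valued metric space and let $C_{x_0,r}^{C^{\ast}}$ be any circle on $X$ (with $x_0\in X$, $r\in\mathbb{A}_+$). Define $\varphi:X\to\mathbb{A}_+$ by $\varphi(x)=d(x,x_0)$ for all $x\in X$. If $T:X\to X$ is a self-mapping satisfying $$d(x,Tx)\preceq \varphi(x)-\varphi(Tx)\qquad\text{and}\qquad r\preceq d(Tx,x_0)$$ for all $x\in C_{x_0,r}^{C^{\ast}}$, then the circle $C_{x_0,r}^{C^{\ast}}$ is a fixed circle of $T$.
   Context: $\mathbb{A}$ is a unital $C^{\ast}$-algebra with unit $I$ and zero element $\theta$. $\mathbb{A}_h=\{a\in\mathbb{A}: a=a^{\ast}\}$. An element $a\in\mathbb{A}$ is positive, written $\theta\preceq a$, if $a\in\mathbb{A}_h$ and its spectrum is contained in $[0,\infty)$; $\mathbb{A}_+$ is the set of positive elements (so $\theta\in\mathbb{A}_+$). For $a,b\in\mathbb{A}_h$, $a\preceq b$ means $b-a\in\mathbb{A}_+$. A $C^{\ast}$-algebra valued metric space $(X,\mathbb{A},d)$ is a nonempty set $X$ with a map $d:X\times X\to\mathbb{A}$ such that for all $x,y,z\in X$: (i) $\theta\preceq d(x,y)$, and $d(x,y)=\theta$ if and only if $x=y$; (ii) $d(x,y)=d(y,x)$; (iii) $d(x,y)\preceq d(x,z)+d(z,y)$. For $x_0\in X$ and $r\in\mathbb{A}_+$, the circle with center $x_0$ and radius $r$ is $C_{x_0,r}^{C^{\ast}}=\{x\in X: d(x,x_0)=r\}$.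 For a self-mapping $T:X\to X$, the circle $C_{x_0,r}^{C^{\ast}}$ is called a fixed circle of $T$ if $Tx=x$ for all $x\in C_{x_0,r}^{C^{\ast}}$. *)

(* Defs.v *)
From HB Require Import structures.
From mathcomp Require Import all_boot all_order all_algebra.
From mathcomp Require Import all_classical all_reals all_analysis.
From mathcomp Require Import complex.
Set Implicit Arguments.
Unset Strict Implicit.
Unset Printing Implicit Defensive.
Import Order.TTheory GRing.Theory Num.Theory.
Import numFieldNormedType.Exports.
Local Open Scope classical_set_scope.
Local Open Scope ring_scope.

(* Unital complex C*-algebras. The multiplication is part of the mixin because
   Hierarchy Builder rejects a structure joining rings with normed modules:
   their join would compete with [numDomainType]. The norm of a normed module
   over R[i] takes its values in (the nonnegative reals of) R[i].
   [cone] may be equal to 0, so the zero algebra is included. *)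
HB.mixin Record isCStarAlgebra (R : realType) A
    of CompleteNormedModule R[i] A := {
  cone : A ;
  cmul : A -> A -> A ;
  star : A -> A ;
  cmulA : associative cmul ;
  cmul1l : left_id cone cmul ;
  cmul1r : right_id cone cmul ;
  cmulDl : left_distributive cmul +%R ;
  cmulDr : right_distributive cmul +%R ;
  cscalerAl : forall (z : R[i]) (a b : A), z *: cmul a b = cmul (z *: a) b ;
  cscalerAr : forall (z : R[i]) (a b : A), z *: cmul a b = cmul a (z *: b) ;
  cnormM : forall a b : A, `|cmul a b| <= `|a| * `|b| ;
  starK : involutive star ;
  starD : {morph star : a b / a + b} ;
  starZ : forall (z : R[i]) (a : A), star (z *: a) = z^* *: star a ;
  starM : forall a b : A, star (cmul a b) = cmul (star b) (star a) ;
  cstar_norm : forall a : A, `|cmul (star a) a| = `|a| ^+ 2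
}.

#[short(type="cstarAlgType")]
HB.structure Definition CStarAlgebra (R : realType) :=
  {A of CompleteNormedModule R[i] A & isCStarAlgebra R A}.

Section CStarOrder.
Variables (R : realType) (A : cstarAlgType R).
Implicit Types a b : A.

Definition selfadjoint a : Prop := star a = a.

Definition invertible a : Prop := exists b : A, cmul a b = cone /\ cmul b a = cone.

Definition spectrum a : set R[i] := [set z | ~ invertible (z *: cone - a)].

(* On R[i], [0 <= z] means that z is real and nonnegative. *)
Definition cpositive a : Prop :=
  selfadjoint a /\ spectrum a `<=` [set z | 0 <= z].

(* The order is a relation on the self-adjoint part of A. *)
Definition cle a b : Prop :=
  [/\ selfadjoint a, selfadjoint b & cpositive (b - a)].

End CStarOrder.

Notation "a ⪯ b" := (cle a b) (at level 70, no associativity) : ring_scope.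

Record cstarMetricSpace (R : realType) (A : cstarAlgType R) := CStarMetricSpace {
  cpoint :> Type ;
  cdist : cpoint -> cpoint -> A ;
  cpoint_inhabited : inhabited cpoint ;
  cdist_ge0 : forall x y, cpositive (cdist x y) ;
  cdist_eq0 : forall x y, cdist x y = 0 <-> x = y ;
  cdistC : forall x y, cdist x y = cdist y x ;
  cdist_triangle : forall x y z, cdist x y ⪯ cdist x z + cdist z y
}.

Section Circles.
Variables (R : realType) (A : cstarAlgType R) (X : cstarMetricSpace A).

Definition circle (x0 : X) (r : A) : set X := [set x | cdist x x0 = r].

Definition fixed_circle (T : X -> X) (x0 : X) (r : A) : Prop :=
  forall x, circle x0 r x -> T x = x.

End Circles.

(* Main.v *)
Require Import Defs.
From HB Require Import structures.
From mathcomp Require Import all_boot all_order all_algebra.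
From mathcomp Require Import all_classical all_reals all_analysis.
From mathcomp Require Import complex.
From mathcomp Require Import lra.
Import Order.TTheory GRing.Theory Num.Theory.
Import numFieldNormedType.Exports.
Local Open Scope classical_set_scope.
Local Open Scope ring_scope.

(** Let x be on the circle, p = d(x, Tx), q = (r - d(Tx, x0)) - p and
    s = d(Tx, x0) - r. The hypotheses say that p, q, s are positive, and they
    add up to zero. So p = 0, that is Tx = x, provided that three
    positive elements with zero sum vanish (cpositive_addr3_eq0).

    That last fact has to be derived from the definition of positivity by
    the spectrum. The bridge is a norm estimate (cpositive_rnorm_realB_le):
    if p is positive and t is at least the norm of p, then t - p has norm at most
    t. Given this, take t = |q| + |s|, which is at least |p|: both t - p and
    t + p = (|q| - q) + (|s| - s) have norm at most t, so t^2 + p^2, the mean of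
    their squares, has norm at most t^2. In a C*-algebra the norm of t^2 + p^2 is
    at least t^2 + |p|^2 when p is self-adjoint and nonzero, whence p = 0
    (rnorm_realBD_le_eq0).

    The norm estimate usually comes from the spectral radius formula. Here it
    is obtained by algebra alone. A failure of the estimate gives
    a self-adjoint g of norm 1 with |1 - g| <= 1 and 1 - g invertible. The
    geometric sum 1 + g^2 + g^4 + ... with 2 ^ m terms factors as the product of
    the 1 + (g^(2^i))^2, and each factor doubles the norm, because
    |(1 + h^2) x| >= 2 |h x| for commuting self-adjoint h and x
    (le_rnorm_sqr1DM). So the sums are unbounded, while their products with
    1 - g^2 are bounded; this contradicts the invertibility of 1 - g
    (not_left_inverse_1B). *)

(** * The ring underlying a C*-algebra *)

(** A second name for the carrier, so that the ring structure does not compete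
    with the normed-module structure. The ring may be zero, so it is not
    an algebra in the sense of the hierarchy; scalars move across products by
    cscaleAl and cscaleAr. *)
Definition cring {R : realType} (A : cstarAlgType R) : Type := A.

HB.instance Definition _ (R : realType) (A : cstarAlgType R) :=
  GRing.Lmodule.copy (cring A) A.
HB.instance Definition _ (R : realType) (A : cstarAlgType R) :=
  GRing.Zmodule_isPzRing.Build (cring A) (@cmulA R A) (@cmul1l R A)
    (@cmul1r R A) (@cmulDl R A) (@cmulDr R A).

(** The norm read in R, where the order is total and linear arithmetic applies,
    instead of R[i]. *)
Definition rnorm {R : realType} {A : cstarAlgType R} (a : cring A) : R :=
  complex.Re `|a : A|.

Definition cstar {R : realType} {A : cstarAlgType R} (a : cring A) : cring A :=
  star a.

Section CStarRing.
Variables (R : realType) (A : cstarAlgType R).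
Implicit Types (a b c g x : cring A) (t : R) (z : R[i]).

Local Notation "t %:I" := (t%:C%C *: (1 : cring A))
  (format "t %:I").

Lemma complex_rnorm a : (rnorm a)%:C%C = `|a : A|.
Proof. exact: (RRe_real (normr_real (a : A))). Qed.

Lemma rnorm_ge0 a : 0 <= rnorm a.
Proof. by rewrite -lecR complex_rnorm; exact: normr_ge0. Qed.

Lemma rnorm0_eq0 a : rnorm a = 0 -> a = 0.
Proof. by move=> a0; apply/eqP; rewrite -normr_eq0 -complex_rnorm a0. Qed.

Lemma rnormD a b : rnorm (a + b) <= rnorm a + rnorm b.
Proof. by rewrite -lecR rmorphD /= !complex_rnorm; exact: ler_normD. Qed.

Lemma rnormN a : rnorm (- a) = rnorm a.
Proof. by rewrite /rnorm; congr complex.Re; exact: normrN. Qed.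

Lemma rnormM a b : rnorm (a * b) <= rnorm a * rnorm b.
Proof. by rewrite -lecR rmorphM /= !complex_rnorm; exact: Defs.cnormM. Qed.

Lemma rnormZ t a : rnorm (t%:C%C *: a) = `|t| * rnorm a.
Proof.
apply: (@complexI R); rewrite rmorphM /= !complex_rnorm.
by have := normrZ t%:C%C (a : A); rewrite normc_def /= expr0n /= addr0 sqrtr_sqr.
Qed.

Lemma rnormMn a n : rnorm (a *+ n) = n%:R * rnorm a.
Proof.
by rewrite -scaler_nat -(rmorph_nat (real_complex R) n) rnormZ ger0_norm ?ler0n.
Qed.

Lemma rnorm_starM a : rnorm (cstar a * a) = rnorm a ^+ 2.
Proof.
apply: (@complexI R); rewrite rmorphXn /= !complex_rnorm; exact: cstar_norm.
Qed.

Lemma cstarK : involutive (@cstar R A). Proof. exact: starK. Qed.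

Lemma cstarD a b : cstar (a + b) = cstar a + cstar b. Proof. exact: starD. Qed.

Lemma cstarM a b : cstar (a * b) = cstar b * cstar a. Proof. exact: starM. Qed.

Lemma cstarZ z a : cstar (z *: a) = (z^*)%C *: cstar a. Proof. exact: starZ. Qed.

Lemma cscaleAl z a b : z *: (a * b) = (z *: a) * b. Proof. exact: cscalerAl. Qed.

Lemma cscaleAr z a b : z *: (a * b) = a * (z *: b). Proof. exact: cscalerAr. Qed.

Lemma cstarN a : cstar (- a) = - cstar a.
Proof. by rewrite -scaleN1r cstarZ rmorphN1 scaleN1r. Qed.

Lemma cstar1 : cstar (1 : cring A) = 1.
Proof. by have := cstarM (cstar 1) (1 : cring A); rewrite mulr1 cstarK mulr1. Qed.

Lemma cstar_real t a : cstar (t%:C%C *: a) = t%:C%C *: cstar a.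
Proof. by rewrite cstarZ conjc_real. Qed.

(** Divide |a|^2 = |a^* a| <= |a^*| |a| by |a|. *)
Lemma le_rnorm_star a : rnorm a <= rnorm (cstar a).
Proof.
have := rnormM (cstar a) a; rewrite rnorm_starM expr2.
have := rnorm_ge0 a; rewrite le_eqVlt => /orP[/eqP <- _|a0]; first exact: rnorm_ge0.
by rewrite ler_pM2r.
Qed.

Lemma rnorm_star a : rnorm (cstar a) = rnorm a.
Proof.
apply/eqP; rewrite eq_le le_rnorm_star andbT.
by have := le_rnorm_star (cstar a); rewrite cstarK.
Qed.

Lemma rnorm_sqr a : cstar a = a -> rnorm (a ^+ 2) = rnorm a ^+ 2.
Proof. by move=> sa; rewrite -rnorm_starM sa expr2. Qed.

(** The norm of the unit is 1, or 0 in the zero algebra. *)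
Lemma rnorm1_le1 : rnorm (1 : cring A) <= 1.
Proof.
have := rnorm_sqr _ cstar1; rewrite expr1n => e.
have := rnorm_ge0 (1 : cring A); nra.
Qed.

Lemma cstar_comm a b : cstar a = a -> cstar b = b -> GRing.comm a b ->
  cstar (a * b) = a * b.
Proof. by move=> sa sb ab; rewrite cstarM sa sb. Qed.

Lemma cstarX a n : cstar a = a -> cstar (a ^+ n) = a ^+ n.
Proof.
move=> sa; elim: n => [|n IH]; first by rewrite expr0 cstar1.
by rewrite exprS cstarM IH sa -exprSr -exprS.
Qed.

(** * Lower bounds for the norm of a sum of squares *)

(** With c = a + i b, commutation gives a^2 + b^2 = c^* c, whose norm is
    the square of that of c, and a is the real part of c. *)
Lemma le_rnorm_sqrD a b : cstar a = a -> cstar b = b -> GRing.comm a b ->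
  rnorm a ^+ 2 <= rnorm (a ^+ 2 + b ^+ 2).
Proof.
move=> sa sb ab; pose c := a + 'i%C *: b.
have sc : cstar c = a - 'i%C *: b.
  rewrite /c cstarD cstarZ sa sb -scaleNr; congr (_ + _ *: _).
  by apply/eqP; rewrite eq_complex /= oppr0 !eqxx.
have <- : cstar c * c = a ^+ 2 + b ^+ 2.
  rewrite sc /c mulrDr !mulrDl !mulNr -!cscaleAl -!cscaleAr scalerA -ab -(expr2 'i%C).
  by rewrite sqr_i scaleN1r opprK addrA subrK -!expr2.
rewrite rnorm_starM ler_sqr ?nnegrE ?rnorm_ge0//.
have : rnorm (a + a) <= 2 * rnorm c.
  have -> : a + a = cstar c + c by rewrite sc /c addrACA addNr addr0.
  by rewrite (le_trans (rnormD _ _))// rnorm_star mulr_natl mulr2n.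
by rewrite -mulr2n rnormMn ler_pM2l.
Qed.

(** Since (1 + g^2)^2 = (2 g)^2 + (1 - g^2)^2, the square of (1 + g^2) x is a sum
    of commuting squares, one of which is (2 g x)^2. *)
Lemma le_rnorm_sqr1DM g x : cstar g = g -> cstar x = x -> GRing.comm g x ->
  2 * rnorm (g * x) <= rnorm ((1 + g ^+ 2) * x).
Proof.
move=> sg sx gx.
have xg2 : GRing.comm x (g ^+ 2) by exact/commrX/commr_sym.
have sg2 : cstar (g ^+ 2) = g ^+ 2 by exact: cstarX.
have sD : cstar (1 + g ^+ 2) = 1 + g ^+ 2 by rewrite cstarD cstar1 sg2.
have sB : cstar (1 - g ^+ 2) = 1 - g ^+ 2 by rewrite cstarD cstarN cstar1 sg2.
have xD : GRing.comm x (1 + g ^+ 2) by apply: commrD => //; exact: commr1.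
have xB : GRing.comm x (1 - g ^+ 2) by apply: commrB => //; exact: commr1.
have gB : GRing.comm g (1 - g ^+ 2) by apply: commrB; [exact: commr1|exact: commrX].
have sgx := cstar_comm _ _ sg sx gx.
have sBx := cstar_comm _ _ sB sx (commr_sym xB).
have gxB : GRing.comm (g * x) ((1 - g ^+ 2) * x).
  apply: commr_sym; apply: commrM; apply: commr_sym; apply: commrM => //.
have : rnorm ((g * x) *+ 2) ^+ 2 <= rnorm ((1 + g ^+ 2) * x) ^+ 2.
  rewrite -[leRHS]rnorm_sqr; last exact: cstar_comm.
  have -> : ((1 + g ^+ 2) * x) ^+ 2 = (g * x *+ 2) ^+ 2 + ((1 - g ^+ 2) * x) ^+ 2.
    rewrite exprMn_comm; last exact: commr_sym.
    rewrite [in RHS]exprMn_comm; last exact: commr_sym.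
    rewrite exprMn_n exprMn_comm//.
    rewrite -mulrnAl -mulrDl; congr (_ * _).
    rewrite [1 + _]addrC sqrrD1 -[1 - _]opprB sqrrN sqrrB1.
    rewrite (mulrnDr (g ^+ 2) 2 2 : _ *+ 2 ^ 2 = _) [in RHS]addrA.
    by congr (_ + 1); rewrite [RHS]addrC [RHS]addrA subrK.
  apply: le_rnorm_sqrD => //.
    by rewrite mulr2n cstarD sgx.
  by rewrite mulr2n; apply: commr_sym; apply: commrD; exact: commr_sym.
rewrite ler_sqr ?nnegrE ?rnorm_ge0//; apply: le_trans.
by rewrite rnormMn.
Qed.

(** * Positivity in terms of the norm *)

(** The product is the geometric sum of the even powers of g up to exponent
    2 ^ m.+1 - 2. *)
Lemma mul_prod_1DX2 g m :
  (1 - g ^+ 2) * (\prod_(i < m) (1 + (g ^+ (2 ^ i)) ^+ 2)) = 1 - g ^+ (2 ^ m.+1).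
Proof.
elim: m => [|m IH]; first by rewrite big_ord0 mulr1.
rewrite big_ord_recr /= mulrA IH -exprM -expnSr.
rewrite mulrDr mulr1 mulrBl mul1r addrA subrK -exprD addnn.
by rewrite -mul2n -expnS.
Qed.

Lemma rnormX_le1 g n : rnorm g <= 1 -> rnorm (g ^+ n) <= 1.
Proof.
move=> g1; elim: n => [|n IH]; first exact: rnorm1_le1.
by rewrite exprS (le_trans (rnormM _ _))// mulr_ile1 ?rnorm_ge0.
Qed.

(** The C*-identity settles the exponents 2 ^ n, and submultiplicativity
    the smaller ones. *)
Lemma rnormX_eq1 g n : cstar g = g -> rnorm g = 1 -> rnorm (g ^+ n) = 1.
Proof.
move=> sg g1; apply/eqP; rewrite eq_le rnormX_le1 ?g1//=.
have <- : rnorm (g ^+ (2 ^ n)) = 1.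
  elim: n => [|n IH]; first by rewrite expr1.
  by rewrite expnSr exprM rnorm_sqr ?IH ?expr1n//; exact: cstarX.
rewrite -(subnKC (ltnW (ltn_expl n (ltnSn 1)))) exprD.
rewrite (le_trans (rnormM _ _))// ler_piMr ?rnorm_ge0//.
by rewrite rnormX_le1 ?g1.
Qed.

(** Each factor at least doubles the norm by le_rnorm_sqr1DM, at the price of one
    more power of g; this is why the bound is proved for all g ^+ M at once. *)
Lemma ge_rnorm_prod_1DX2 g m M : cstar g = g -> rnorm g = 1 ->
  2 ^+ m <= rnorm (g ^+ M * \prod_(i < m) (1 + (g ^+ (2 ^ i)) ^+ 2)).
Proof.
move=> sg g1; pose P m := \prod_(i < m) (1 + (g ^+ (2 ^ i)) ^+ 2).
have gF i : GRing.comm g (1 + (g ^+ (2 ^ i)) ^+ 2).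
  by apply: commrD; [exact: commr1|do 2 apply: commrX].
have gP k : GRing.comm g (P k) by apply: commr_prod => i _.
have sP k : cstar (P k) = P k.
  elim: k => [|k IH]; first by rewrite /P big_ord0 cstar1.
  rewrite /P big_ord_recr /= -/(P k); apply: cstar_comm => //.
    by rewrite cstarD cstar1 !cstarX.
  by apply: commrD; [exact: commr1|do 2 apply: commrX; exact: commr_sym].
rewrite -/(P m); elim: m M => [|m IH] M.
  by rewrite /P big_ord0 mulr1 rnormX_eq1.
rewrite /P big_ord_recr /= -/(P m).
set h := g ^+ (2 ^ m).
have hP : GRing.comm h (g ^+ M * P m).
  apply: commr_sym; apply: commrX; apply: commr_sym; apply: commrM => //.
  exact: commrX.
have sgP : cstar (g ^+ M * P m) = g ^+ M * P m.
  apply: cstar_comm => //; first exact: cstarX.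
  by apply: commr_sym; apply: commrX; apply: commr_sym.
have -> : g ^+ M * (P m * (1 + h ^+ 2)) = (1 + h ^+ 2) * (g ^+ M * P m).
  rewrite mulrA; apply: commrD; first exact: commr1.
  by apply: commrX; apply: commr_sym.
apply: le_trans (le_rnorm_sqr1DM _ _ (cstarX _ _ sg) sgP hP).
by rewrite exprS ler_pM2l// mulrA -exprD.
Qed.

(** The element 1 - g sends the product S of the two previous lemmas, multiplied
    by 1 + g, to an element of norm at most 2. But S is unbounded, and so is
    (1 + g) S = 2 S - (1 - g) S because 1 - g has norm at most 1. *)
Lemma not_left_inverse_1B g c : cstar g = g -> rnorm g = 1 ->
  rnorm (1 - g) <= 1 -> c * (1 - g) <> 1.
Proof.
move=> sg g1 le1 cg.
have bound m : 2 ^+ m <= 2 * rnorm c.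
  have := ge_rnorm_prod_1DX2 g m 0 sg g1; have := mul_prod_1DX2 g m.
  rewrite expr0 mul1r; set S := \prod_(i < m) _ => eS /le_trans; apply.
  have {eS} e : (1 + g) * S = c * (1 - g ^+ (2 ^ m.+1)).
    have fg : 1 - g ^+ 2 = (1 - g) * (1 + g).
      by rewrite mulrDr mulr1 mulrBl mul1r addrA subrK.
    by rewrite -eS fg !mulrA cg mul1r.
  have le2 : rnorm ((1 + g) * S) <= 2 * rnorm c.
    rewrite e (le_trans (rnormM _ _))// mulrC ler_wpM2r ?rnorm_ge0//.
    rewrite (le_trans (rnormD _ _))// rnormN -[2]/(1 + 1) lerD ?rnorm1_le1//.
    by rewrite rnormX_le1 ?g1.
  apply: le_trans le2.
  have eS : S + S = (1 + g) * S + (1 - g) * S.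
    by rewrite -mulrDl addrACA addrN addr0 mulrDl mul1r.
  have : rnorm (S + S) <= rnorm ((1 + g) * S) + rnorm S.
    rewrite eS (le_trans (rnormD _ _))// lerD2l (le_trans (rnormM _ _))//.
    by rewrite ler_piMl ?rnorm_ge0.
  by rewrite -mulr2n rnormMn mulr_natl mulr2n lerD2r.
have c0 : 0 <= 2 * rnorm c by rewrite mulr_ge0 ?rnorm_ge0.
have := bound (Num.bound (2 * rnorm c)); rewrite leNgt.
rewrite (lt_le_trans (archi_boundP c0))//.
by rewrite -natrX ler_nat ltnW// ltn_expl.
Qed.

(** If t - p had norm gam > t, then g = (t - p) / gam would be a unit vector with
    1 - g = (gam - t + p) / gam of norm at most 1. As t - gam < 0 is outside
    the spectrum of p, 1 - g would be invertible, against
    not_left_inverse_1B. *)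
Lemma cpositive_rnorm_realB_le (p : cring A) t :
  @cpositive R A p -> rnorm p <= t -> rnorm (t%:I - p) <= t.
Proof.
move=> [sp specp] pt; rewrite leNgt; apply/negP => lt_t.
have t0 : 0 <= t := le_trans (rnorm_ge0 _) pt.
set y := t%:I - p in lt_t; set gam := rnorm y in lt_t.
have gam0 : 0 < gam by exact: le_lt_trans lt_t.
pose g : cring A := (gam^-1)%:C%C *: y.
have sg : cstar g = g.
  by rewrite cstar_real /y cstarD cstarN cstar_real cstar1 [cstar p]sp.
have g1 : rnorm g = 1 by rewrite rnormZ ger0_norm ?invr_ge0 ?ltW// mulVf ?gt_eqF.
have eg : gam%:C%C *: (1 - g) = (gam - t)%:I + p.
  rewrite scalerBr /g scalerA -rmorphM /= mulfV ?gt_eqF// scale1r /y.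
  by rewrite opprB rmorphB /= scalerBl addrA addrAC.
have le1 : rnorm (1 - g) <= 1.
  have eN : gam * rnorm (1 - g) = rnorm (gam%:C%C *: (1 - g)).
    by rewrite rnormZ gtr0_norm.
  rewrite -(ler_pM2l gam0) mulr1 eN eg (le_trans (rnormD _ _))//.
  rewrite rnormZ ger0_norm; last lra.
  have := rnorm1_le1; have := rnorm_ge0 (1 : cring A); nra.
have : ~ spectrum (A:=A) p (t - gam)%:C%C.
  by move=> /specp /=; rewrite ler0c; lra.
move=> /contrapT [b [_ bp]].
have {}bp : (b : cring A) * ((t - gam)%:I - p) = 1 by exact: bp.
apply: (not_left_inverse_1B g (- gam%:C%C *: (b : cring A)) sg g1 le1).
rewrite -cscaleAl cscaleAr scaleNr eg opprD -scaleNr -rmorphN opprB; exact: bp.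
Qed.

(** The norm of t^2 + a^2 is the largest possible one. For t equal to the norm
    of a this is the case x = 1 of le_rnorm_sqr1DM. A larger t follows by
    convexity: the norm of t + a^2 grows at most as fast as t, and the case
    above says that it already grows at full speed between 0 and the square of
    the norm of a, so it cannot slow down later. *)
Lemma ge_rnorm_realD_sqr a t : cstar a = a -> 0 < rnorm a -> rnorm a <= t ->
  t ^+ 2 + rnorm a ^+ 2 <= rnorm ((t ^+ 2)%:I + a ^+ 2).
Proof.
move=> sa; set u := rnorm a => u_gt0 le_ut.
pose g : cring A := (u^-1)%:C%C *: a.
have sg : cstar g = g by rewrite cstar_real sa.
have g1 : rnorm g = 1.
  by rewrite rnormZ ger0_norm ?invr_ge0 ?ltW// mulVf ?gt_eqF.
have le2 : 2 <= rnorm (1 + g ^+ 2).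
  have := le_rnorm_sqr1DM g 1 sg cstar1 (commr1 g).
  by rewrite !mulr1 g1 mulr1.
have e2 : (t ^+ 2)%:C%C *: (1 + g ^+ 2) =
    ((t ^+ 2)%:I + a ^+ 2) + ((t / u) ^+ 2 - 1)%:C%C *: (a ^+ 2).
  have -> : g ^+ 2 = ((u ^-1) ^+ 2)%:C%C *: a ^+ 2.
    by rewrite expr2 -cscaleAl -cscaleAr scalerA -expr2 rmorphXn.
  rewrite scalerDr scalerA -rmorphM -exprMn rmorphB scalerBl rmorph1 scale1r.
  by rewrite -addrA [a ^+ 2 + _]addrC subrK.
have : t ^+ 2 * 2 <=
    rnorm ((t ^+ 2)%:I + a ^+ 2) + ((t / u) ^+ 2 - 1) * u ^+ 2.
  apply: le_trans (_ : t ^+ 2 * rnorm (1 + g ^+ 2) <= _).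
    by rewrite ler_wpM2l ?sqr_ge0.
  have k0 : 0 <= (t / u) ^+ 2 - 1.
    by rewrite subr_ge0 exprn_ege1// ler_pdivlMr// mul1r.
  have <- : `|t ^+ 2| = t ^+ 2 by rewrite ger0_norm ?sqr_ge0.
  rewrite -rnormZ e2 (le_trans (rnormD _ _))// [in leRHS]ger0_norm ?sqr_ge0//.
  by rewrite lerD// rnormZ ger0_norm// rnorm_sqr.
rewrite mulrBl mul1r expr_div_n divfK ?sqrf_eq0 ?gt_eqF//.
lra.
Qed.

(** The parallelogram identity (t + a)^2 + (t - a)^2 = 2 (t^2 + a^2) bounds the
    norm of t^2 + a^2 by t^2, which leaves no room for a nonzero a. *)
Lemma rnorm_realBD_le_eq0 a t : cstar a = a -> rnorm (t%:I - a) <= t ->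
  rnorm (t%:I + a) <= t -> a = 0.
Proof.
move=> sa leB leD; apply: rnorm0_eq0; apply/eqP.
have t0 : 0 <= t := le_trans (rnorm_ge0 _) leB.
have eT2 : t%:I ^+ 2 = (t ^+ 2)%:I.
  by rewrite expr2 -cscaleAl mul1r scalerA -expr2 rmorphXn.
set T := t%:I in leB leD eT2.
have sT : cstar T = T by rewrite cstar_real cstar1.
have le_at : rnorm a <= t.
  have : rnorm (a + a) <= t + t.
    have -> : a + a = (T + a) - (T - a).
      by rewrite opprB [RHS]addrC addrA subrK.
    by rewrite (le_trans (rnormD _ _))// rnormN lerD.
  by rewrite -!mulr2n rnormMn -[t *+ 2]mulr_natl ler_pM2l.
have leS : rnorm (T ^+ 2 + a ^+ 2) <= t ^+ 2.
  have : rnorm ((T ^+ 2 + a ^+ 2) *+ 2) <= t ^+ 2 + t ^+ 2.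
    have -> : (T ^+ 2 + a ^+ 2) *+ 2 = (T + a) ^+ 2 + (T - a) ^+ 2.
      rewrite [(T + a) ^+ 2]expr2 mulrDl [(T - a) ^+ 2]expr2 mulrBl addrACA.
      rewrite -mulrDr -mulrBr opprB [_ + (a - T)]addrC addrACA subrr addr0.
      by rewrite addrA subrK -!mulr2n !mulrnAr -!expr2 mulrnDl.
    rewrite (le_trans (rnormD _ _))// lerD//.
      by rewrite rnorm_sqr ?ler_sqr ?nnegrE ?rnorm_ge0// cstarD sT sa.
    by rewrite rnorm_sqr ?ler_sqr ?nnegrE ?rnorm_ge0// cstarD cstarN sT sa.
  by rewrite rnormMn -[leRHS]mulr2n -[leRHS]mulr_natl ler_pM2l.
case: (eqVneq (rnorm a) 0) => // aN0; exfalso.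
have a_gt0 : 0 < rnorm a by rewrite lt_def aN0 rnorm_ge0.
have := ge_rnorm_realD_sqr a t sa a_gt0 le_at; rewrite -eT2.
have : 0 < rnorm a ^+ 2 by rewrite exprn_gt0.
lra.
Qed.

(** This is both the closure of the positive cone under addition and its being
    pointed: from p = - (q + s), the norm of t - p is at most t by the choice
    of t, and t + p = (|q| - q) + (|s| - s) has norm at most |q| + |s| = t. *)
Lemma cpositive_addr3_eq0 (p q s : cring A) :
  @cpositive R A p -> @cpositive R A q -> @cpositive R A s ->
  p + q + s = 0 -> p = 0.
Proof.
move=> p0 q0 s0 e.
have ep : p = - (q + s) by apply/eqP; rewrite -addr_eq0 addrA e.
apply: (@rnorm_realBD_le_eq0 p (rnorm q + rnorm s)); first by case: p0.
  by apply: cpositive_rnorm_realB_le => //; rewrite ep rnormN rnormD.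
have -> : (rnorm q + rnorm s)%:I + p =
    ((rnorm q)%:I - q) + ((rnorm s)%:I - s).
  by rewrite ep rmorphD /= scalerDl opprD addrACA.
by rewrite (le_trans (rnormD _ _))// lerD// cpositive_rnorm_realB_le.
Qed.
End CStarRing.

(** * Fixed circles *)

Theorem theorem5 (R : realType) (A : cstarAlgType R) (X : cstarMetricSpace A)
    (x0 : X) (r : A) (r_ge0 : cpositive r) (T : X -> X) :
  let phi : X -> A := fun x => cdist x x0 in
  (forall x, circle x0 r x ->
     cdist x (T x) ⪯ phi x - phi (T x) /\ r ⪯ cdist (T x) x0) ->
  fixed_circle T x0 r.
Proof.
move=> phi H x xr; have [[_ _ q0] [_ _ s0]] := H x xr.
apply/esym/cdist_eq0.
apply: (cpositive_addr3_eq0 R A _ _ _ (cdist_ge0 x (T x)) q0 s0).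
have -> : phi x = r by [].
by rewrite [X in X + _]addrC [X in X + _]subrK addrA subrK subrr.
Qed.
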